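(* Let $2<p<\infty$ and let $\mathcal{D}$ be a dyadic system on $\mathbb{T}$. For every integer $N\ge2$ there exists a finite positive Borel measure $\mu^{(N)}$ on $\mathbb{D}$ such that $$\mathcal{C}_{p,\mathcal{D}}\big(\mu^{(N)}\big)\lesssim_p 1\qquad\text{and}\qquad \mathcal{H}_{p,\mathcal{D}}\big(\mu^{(N)}\big)\gtrsim_p N^{\frac{p}{p-1}},$$ where the implicit constants depend only on $p$ (in particular not on $N$).
   Context: $\mathbb{D}$ is the open unit disc in $\mathbb{C}$, $\mathbb{T}=\partial\mathbb{D}$ is identified with $\mathbb{R}/\mathbb{Z}$ via $t\mapsto e^{2\pi i t}$ and carries normalized Lebesgue measure ($|\mathbb{T}|=1$); $|I|$ is the normalized length of an arc $I$. Dyadic system: $\mathcal{D}=\bigcup_{n\ge0}\mathcal{D}_n$, where for some base point $x\in\mathbb{R}/\mathbb{Z}$, $\mathcal{D}_n=\{[x+k2^{-n},x+(k+1)2^{-n}):0\le k<2^n\}$ is a partition of $\mathbb{T}$ into $2^n$ half-open arcs of length $2^{-n}$ ($\mathcal{D}_0=\{\mathbb{T}\}$). Each $I\in\mathcal{D}_n$ is the disjoint union of its two dyadic children $I_+,I_-\in\mathcal{D}_{n+1}$, ordered counterclockwise. Carleson tent: $Q_I:=\{z=re^{2\pi it}\in\mathbb{D}:1-|I|\le r<1,\ e^{2\pi it}\in I\}$. For a finite positive Borel measure $\mu$ on $\mathbb{D}$, the packing energy is $$\mathcal{C}_{p,\mathcal{D}}(\mu):=\sup_{J\in\mathcal{D},\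 \mu(Q_J)>0}\frac1{\mu(Q_J)}\sum_{I\in\mathcal{D},\ I\subseteq J}\left(\frac{\mu(Q_I)}{|I|}\right)^{\frac{p}{p-2}}|I|$$ and the Haar energy is $$\mathcal{H}_{p,\mathcal{D}}(\mu):=\sup_{J\in\mathcal{D},\ \mu(Q_J)>0}\frac1{\mu(Q_J)}\sum_{I\in\mathcal{D},\ I\subseteq J}\left(\frac{|\mu(Q_{I_+})-\mu(Q_{I_-})|}{|I|}\right)^{\frac{p}{p-1}}|I|.$$ If $\mu=0$, both energies are $0$. *)

(* Defs.v *)
From HB Require Import structures.
From mathcomp Require Import all_boot all_order all_algebra.
From mathcomp Require Import all_classical all_reals all_analysis.
From mathcomp Require Import complex.

Set Implicit Arguments.
Unset Strict Implicit.
Unset Printing Implicit Defensive.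

Import Order.TTheory GRing.Theory Num.Theory.
Import numFieldNormedType.Exports.

Local Open Scope classical_set_scope.
Local Open Scope complex_scope.
Local Open Scope ring_scope.

(* [R[i]] has its library topology only when it is seen as a [numFieldType]. *)
Definition cplx (R : realType) : numFieldType := R[i].

Definition unit_disc (R : realType) : set (cplx R) := [set z | `|z| < 1].
Arguments unit_disc : clear implicits.

(* The disc as a type, with the subspace topology. *)
Definition disc_space (R : realType) : Type := set_type (unit_disc R).

Fact disc_origin_subproof (R : realType) : (0 : cplx R) \in unit_disc R.
Proof. by rewrite inE /unit_disc /= normr0 ltr01. Qed.

Definition disc_origin (R : realType) : disc_space R :=
  exist _ (0 : cplx R) (disc_origin_subproof R).

HB.instance Definition _ (R : realType) :=
  Topological.copy (disc_space R) (set_type (unit_disc R)).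
HB.instance Definition _ (R : realType) :=
  isPointed.Build (disc_space R) (disc_origin R).

(* The disc with its Borel sigma-algebra. *)
Definition disc (R : realType) : measurableType _ :=
  g_sigma_algebraType (@open (disc_space R)).

(* The point e^{2 pi i t} of the unit circle. *)
Definition circle_point (R : realType) (t : R) : cplx R :=
  cos (2 * pi * t) +i* sin (2 * pi * t).

(* The pair (n, k) with k < 2^n stands for the k-th arc of generation n.
   Distinct pairs give distinct arcs, so a sum over pairs is a sum over arcs. *)
Definition dyadic : set (nat * nat) := [set I | (I.2 < 2 ^ I.1)%N].

(* The normalized length of the arc I. *)
Definition arc_length (R : realType) (I : nat * nat) : R := 2 ^- I.1.

(* The half-open arc [x + k 2^-n, x + (k + 1) 2^-n) of R/Z, as a set of points
   of the unit circle; the base point is given by a representative x in R. *)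
Definition arc (R : realType) (x : R) (I : nat * nat) : set (cplx R) :=
  [set circle_point t | t in
    `[x + I.2%:R * arc_length R I, x + I.2.+1%:R * arc_length R I[].

(* The children I_+ and I_-, in counterclockwise order. *)
Definition child_plus (I : nat * nat) : nat * nat := (I.1.+1, I.2.*2).
Definition child_minus (I : nat * nat) : nat * nat := (I.1.+1, I.2.*2.+1).

Definition tent (R : realType) (x : R) (I : nat * nat) : set (disc R) :=
  [set z | exists r t : R,
    [/\ set_val z = r%:C * circle_point t,
        1 - arc_length R I <= r < 1 & arc x I (circle_point t)]].

Definition tent_mass (R : realType) (x : R)
    (mu : {finite_measure set (disc R) -> \bar R}) (I : nat * nat) : R :=
  fine (mu (tent x I)).

(* The common form of both energies: [a I] is the summand attached to I. *)
Definition carleson_sup (R : realType) (x : R)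
    (mu : {finite_measure set (disc R) -> \bar R}) (a : nat * nat -> R) :
    \bar R :=
  if mu [set: disc R] == 0%E then 0%E else
  ereal_sup [set ((tent_mass x mu J)^-1%:E *
                  \esum_(I in dyadic `&` [set I | arc x I `<=` arc x J])
                    (a I)%:E)%E
            | J in dyadic `&` [set J | 0 < tent_mass x mu J]].

Definition packing_energy (R : realType) (p x : R)
    (mu : {finite_measure set (disc R) -> \bar R}) : \bar R :=
  carleson_sup x mu (fun I =>
    (tent_mass x mu I / arc_length R I) `^ (p / (p - 2)) * arc_length R I).

Definition haar_energy (R : realType) (p x : R)
    (mu : {finite_measure set (disc R) -> \bar R}) : \bar R :=
  carleson_sup x mu (fun I =>
    (`|tent_mass x mu (child_plus I) - tent_mass x mu (child_minus I)|
       / arc_length R I) `^ (p / (p - 1)) * arc_length R I).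

(* Main.v *)
(* Let q = p/(p-2), s = p/(p-1), r = 1/(p-2), so that q = 1 + 2r and
   s(1 + r) = q, and let m_I = mu(Q_I)/|I|.  Any nonnegative m on the dyadic
   tree with finitely many nonzero generations and m_I >= (m_{I+} + m_{I-})/2
   is the density of a sum of point masses, one in each top half of a tent.
   Let m follow the autonomous rule that replaces m by
   m(1 - m^{2r} +- N m^r) as long as m <= t, where t > 0 is small in terms of
   N, and by 0 once m > t.  The mass lost at I is at least m_I^q |I|, so the
   packing sum below J telescopes to at most mu(Q_J).  On the other hand, the
   Haar summand at I is (N m_I^{1+r})^s |I| = N^s m_I^q |I|, which is N^s times
   the mass lost at I while m_I <= t.  It remains to see that at least half of
   the mass is lost in this way when the root density is small: in terms of the
   time in which m decays exponentially, m is a geometric random walk with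
   volatility N, and m^{1 + 1/N^2} is a supermartingale, so little mass ever
   crosses the level t; and almost no mass survives after many generations. *)

From HB Require Import structures.
Require Import Defs.
From mathcomp Require Import all_boot all_order all_algebra.
From mathcomp Require Import all_classical all_reals all_analysis.
From mathcomp Require Import complex ring lra.

Import Order.TTheory GRing.Theory Num.Theory.
Local Open Scope ring_scope.

(** * A Bernoulli inequality and dyadic splitting of sums *)

(** Young's inequality for the product of (1 + u)^e and 1, with conjugate exponents 1/e and 1/(1 -
    e). *)
Lemma powR_bernoulli {R : realType} (u e : R) :
  -1 <= u -> 0 < e < 1 -> (1 + u) `^ e <= 1 + e * u.
Proof.
move=> u1 /andP[e0 e1].
have hu : 0 <= 1 + u by lra.
have := @conjugate_powR R ((1 + u) `^ e) 1 e^-1 (1 - e)^-1 (powR_ge0 _ _) ler01.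
rewrite !invrK mulr1 powR1 -powRrM divff ?gt_eqF// powRr1// !invr_gt0 subr_gt0.
by move=> /(_ e0 e1 (subrKC _ _)) /le_trans; apply; lra.
Qed.

Lemma sum_pow2S {R : nmodType} (n : nat) (f : nat -> R) :
  \sum_(k < (2 ^ n.+1)%N) f k = \sum_(k < (2 ^ n)%N) (f k.*2 + f k.*2.+1).
Proof.
rewrite expnS mul2n; elim: (2 ^ n)%N => [|m IH]; first by rewrite !big_ord0.
by rewrite doubleS !big_ord_recr /= IH addrA.
Qed.

(** * The density recursion and its one-step estimates *)

(** [K] plays the role of N; [b] is the parity of the child's index, so [true] is the minus child.
    The value 0 stops the process: all the mass then stays in the atom of the parent. *)
Definition child_density {R : realType} (r K t : R) (b : bool) (m : R) : R :=
  if m <= t then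
    m * (1 - m `^ r ^+ 2 + (if b then - (K * m `^ r) else K * m `^ r))
  else 0.

Fixpoint density {R : realType} (r K t m0 : R) (n k : nat) : R :=
  if n is n'.+1 then child_density r K t (odd k) (density r K t m0 n' k./2)
  else m0.

(* The mass lost at an arc of density [m] that has not been stopped yet, divided
   by the length of the arc. *)
Definition absorbed {R : realType} (r t m : R) : R :=
  if m <= t then m * m `^ r ^+ 2 else 0.

Lemma density_children {R : realType} (r K t m0 : R) n k :
  (density r K t m0 n.+1 k.*2 = child_density r K t false (density r K t m0 n k))
  * (density r K t m0 n.+1 k.*2.+1
     = child_density r K t true (density r K t m0 n k)).
Proof. by rewrite /= odd_double uphalf_double doubleK. Qed.

(** When m <= t, K m^r <= 1/2 and K >= 2 give m^r <= 1/4, so the factor of m lies between 0 and 3/2,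
    while m <= 1/2. *)
Lemma child_density_bounds {R : realType} (r K t : R) (b : bool) (m : R) :
  0 < r -> 2 <= K -> 0 < t <= 2^-1 -> K * t `^ r <= 2^-1 ->
  0 <= m -> 0 <= child_density r K t b m <= 1.
Proof.
move=> r0 K2 /andP[t0 t2] Kt m0; rewrite /child_density.
case: (leP m t) => [mt|]; last by rewrite lexx ler01.
have ht : m `^ r <= t `^ r.
  by apply: ge0_ler_powR; rewrite ?nnegrE; lra.
have := powR_ge0 m r; move: (m `^ r) ht => x ht x0.
have hK : K * x <= 2^-1 by nra.
have hK0 : 0 <= K * x by nra.
have hx : x <= 4^-1 by nra.
have hx2 : x ^+ 2 <= 16^-1 by nra.
have hx20 : 0 <= x ^+ 2 by exact: sqr_ge0.
by case: b; apply/andP; split; nra.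
Qed.

Lemma child_density_mean {R : realType} (r K t m : R) : m <= t ->
  (child_density r K t false m + child_density r K t true m) / 2
  = m - absorbed r t m.
Proof. by rewrite /absorbed /child_density => ->; field. Qed.

Lemma child_density_diff {R : realType} (r K t m : R) : m <= t ->
  (child_density r K t false m - child_density r K t true m) / 2
  = K * m * m `^ r.
Proof. by rewrite /child_density => ->; field. Qed.

(** Equality holds up to the level t; above it everything is lost, and m <= 1 gives m^(1 + 2r) <=
    m. *)
Lemma child_density_loss {R : realType} (r K t m : R) : 0 < r -> 0 <= m <= 1 ->
  m * m `^ r ^+ 2
  <= m - (child_density r K t false m + child_density r K t true m) / 2.
Proof.
move=> r0 /andP[m0 m1]; case: (leP m t) => mt.
  by rewrite child_density_mean// /absorbed mt subKr.
rewrite /child_density (lt_geF mt).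
have : m `^ r <= 1 `^ r by apply: ge0_ler_powR; rewrite ?nnegrE ?ler01// ltW.
by rewrite powR1 => x1; rewrite addr0 mul0r subr0 ler_piMr// exprn_ile1// powR_ge0.
Qed.

(* [excess (K ^- 2) t] is a supersolution dominating [m] above the level [t],
   hence it bounds the density of the mass that is eventually stopped. *)
Definition excess {R : realType} (e t m : R) : R := m * (m / t) `^ e.

(* An upper bound for the density left after [j] generations: by
   [m * m ^ (2 r) >= eps ^ (2 r) * (m - eps)] the mean of [m - eps] contracts by
   the factor [1 - eps ^ (2 r)], and the bound is affine in [m], hence is
   compatible with averaging. *)
Definition survivor {R : realType} (r eps : R) (j : nat) (m : R) : R :=
  eps + (1 - eps `^ r ^+ 2) ^+ j * (m - eps).

(** With x = m^r, e = 1/K^2 and u = -x^2 +- Kx, Bernoulli bounds (1 + u)^(1 + e) by (1 + u)(1 + eu).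
    The linear loss cancels the quadratic gain because e K^2 = 1, and the two terms sum to 2 - 2 e
    x^2 (1 - x^2). *)
Lemma excess_drift {R : realType} (r K t m : R) :
  0 < r -> 2 <= K -> 0 < t <= 2^-1 -> K * t `^ r <= 2^-1 -> 0 <= m <= t ->
  excess (K ^- 2) t (child_density r K t false m)
  + excess (K ^- 2) t (child_density r K t true m) <= 2 * excess (K ^- 2) t m.
Proof.
move=> r0 K2 /andP[t0 t2] Kt /andP[m0 mt]; rewrite /child_density mt /excess.
have ht : m `^ r <= t `^ r.
  by apply: ge0_ler_powR; rewrite ?nnegrE; lra.
have := powR_ge0 m r; move: (m `^ r) ht => x ht x0.
have hK : K * x <= 2^-1 by nra.
have hK0 : 0 <= K * x by nra.
have hx : x <= 4^-1 by nra.
have hx2 : x ^+ 2 <= 16^-1 by nra.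
have hx20 : 0 <= x ^+ 2 by exact: sqr_ge0.
set e := K ^- 2.
have K0 : 0 < K by lra.
have eK : e * K ^+ 2 = 1 by rewrite mulVf// expf_neq0// gt_eqF.
have e0 : 0 < e by rewrite invr_gt0 exprn_gt0.
have e1 : e < 1 by rewrite invf_lt1 ?exprn_gt0//; nra.
have step u : -1 <= u ->
    m * (1 + u) * (m * (1 + u) / t) `^ e
    <= m * (m / t) `^ e * ((1 + u) * (1 + e * u)).
  move=> u1; have hu : 0 <= 1 + u by lra.
  have -> : m * (1 + u) / t = m / t * (1 + u) by ring.
  rewrite powRM ?divr_ge0 ?(ltW t0)//.
  have hb := powR_bernoulli _ _ u1 (introT andP (conj e0 e1)).
  have hc : 0 <= m * (m / t) `^ e by rewrite mulr_ge0 ?powR_ge0.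
  rewrite [leLHS](_ : _ = m * (m / t) `^ e * ((1 + u) * (1 + u) `^ e)); last ring.
  by apply: ler_wpM2l => //; apply: ler_wpM2l.
have := lerD (step (- x ^+ 2 + K * x) _) (step (- x ^+ 2 - K * x) _).
rewrite !addrA => /(_ ltac:(lra) ltac:(lra)) /le_trans; apply.
rewrite -mulrDr [leRHS]mulrC; apply: ler_wpM2l; first by rewrite mulr_ge0 ?powR_ge0.
rewrite [leLHS](_ : _ =
  2 - 2 * x ^+ 2 * (1 + e - e * K ^+ 2 - e * x ^+ 2)); last by ring.
have h : 0 <= x ^+ 2 * (e * (1 - x ^+ 2)).
  by rewrite !mulr_ge0//; lra.
by rewrite eK; lra.
Qed.

Lemma survivor_drift {R : realType} (r eps m : R) j :
  0 < r -> 0 < eps <= 1 -> 0 <= m ->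
  survivor r eps j (m - m * m `^ r ^+ 2) <= survivor r eps j.+1 m.
Proof.
move=> r0 /andP[e0 e1] m0; rewrite /survivor lerD2l [_ ^+ j.+1]exprSr -mulrA.
have h1 : eps `^ r <= 1 `^ r.
  by apply: ge0_ler_powR; rewrite ?nnegrE ?ler01// ltW.
rewrite powR1 in h1; have h0 := powR_ge0 eps r.
apply: ler_wpM2l; first by apply: exprn_ge0; nra.
have k0 := sqr_ge0 (eps `^ r).
(* What remains is m^(1 + 2r) >= eps^(2r) (m - eps), whose right side is nonpositive when m <=
   eps. *)
case: (leP m eps) => me.
  by have := mulr_ge0 m0 (sqr_ge0 (m `^ r)); nra.
have : eps `^ r <= m `^ r.
  by apply: ge0_ler_powR; rewrite ?nnegrE; lra.
move=> h; have : eps `^ r ^+ 2 <= m `^ r ^+ 2 by nra.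
by nra.
Qed.

(** * At least half of the root mass is absorbed *)

(** A lower bound for the density absorbed within [j] generations: m minus bounds for the part that
    is stopped above t and for the part still alive. *)
Definition captured {R : realType} (r K t eps : R) (j : nat) (m : R) : R :=
  m - excess (K ^- 2) t m - survivor r eps j m.

(** Up to t, the excess is a supersolution and the survivor bound is affine. Above t the children
    vanish, the excess alone is at least m, and the survivor bound of 0 after [j] generations is at
    most that of m after [j.+1]. *)
Lemma captured_step {R : realType} (r K t eps m : R) j :
  0 < r -> 2 <= K -> 0 < t <= 2^-1 -> K * t `^ r <= 2^-1 -> 0 < eps <= 1 ->
  0 <= m ->
  captured r K t eps j.+1 m <= absorbed r t m +
    (captured r K t eps j (child_density r K t false m) +
     captured r K t eps j (child_density r K t true m)) / 2.
Proof.
move=> r0 K2 t0 Kt e01 m0; case: (leP m t) => mt.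
  have h1 := excess_drift r K t m r0 K2 t0 Kt (introT andP (conj m0 mt)).
  have h2 := survivor_drift r eps m j r0 e01 m0.
  have h3 := child_density_mean r K t m mt.
  rewrite /captured.
  have h4 : (survivor r eps j (child_density r K t false m)
             + survivor r eps j (child_density r K t true m)) / 2
            = survivor r eps j (m - m * m `^ r ^+ 2).
    move: h3; rewrite /absorbed mt => <-; rewrite /survivor.
    by move: ((1 - _) ^+ j) => z; field.
  move: h3; rewrite {1}/absorbed mt => h3.
  by rewrite /absorbed mt; lra.
rewrite /absorbed /child_density (lt_geF mt) /captured /excess mul0r.
move: e01 => /andP[e0 e1]; move: t0 => /andP[t0 _].
have h1 : m <= m * (m / t) `^ (K ^- 2).
  rewrite ler_peMr//.
  have h : 1 `^ (K ^- 2) <= (m / t) `^ (K ^- 2).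
    apply: ge0_ler_powR; rewrite ?nnegrE ?ler01//.
    - by rewrite invr_ge0 exprn_ge0; lra.
    - by rewrite divr_ge0// ltW.
    - by rewrite ler_pdivlMr// mul1r ltW.
  by rewrite powR1 in h.
have h2 : survivor r eps j 0 <= survivor r eps j.+1 m.
  rewrite /survivor lerD2l [_ ^+ j.+1]exprSr -mulrA.
  have h1' : eps `^ r <= 1 `^ r.
    by apply: ge0_ler_powR; rewrite ?nnegrE ?ler01// ltW.
  rewrite powR1 in h1'; have h0 := powR_ge0 eps r.
  apply: ler_wpM2l; first by apply: exprn_ge0; nra.
  have k1 : eps `^ r ^+ 2 <= 1 by exact: exprn_ile1.
  have h2 : 0 <= (1 - eps `^ r ^+ 2) * m by rewrite mulr_ge0// subr_ge0.
  have h3 : 0 <= eps `^ r ^+ 2 * eps by rewrite mulr_ge0// ?sqr_ge0// ltW.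
  by lra.
by lra.
Qed.

Lemma density_bounds {R : realType} (r K t m0 : R) n k :
  0 < r -> 2 <= K -> 0 < t <= 2^-1 -> K * t `^ r <= 2^-1 -> 0 <= m0 <= 1 ->
  0 <= density r K t m0 n k <= 1.
Proof.
move=> r0 K2 ht Kt hm; elim: n k => [|n IH] k //=.
by apply: child_density_bounds => //; case/andP: (IH k./2).
Qed.

(** [captured_step] is iterated: [P n j] is the weighted sum of [captured] over generation [n] with
    [j] generations left, and [G n] is the mass absorbed in generation [n]. *)
Lemma captured_le_absorbed {R : realType} (r K t eps m0 : R) (L : nat) :
  0 < r -> 2 <= K -> 0 < t <= 2^-1 -> K * t `^ r <= 2^-1 -> 0 < eps <= 1 ->
  0 <= m0 <= 1 ->
  captured r K t eps L m0 <=
  \sum_(n < L) \sum_(k < (2 ^ n)%N) absorbed r t (density r K t m0 n k) * 2 ^- n.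
Proof.
move=> r0 K2 ht Kt he hm.
pose P n j := \sum_(k < (2 ^ n)%N) captured r K t eps j (density r K t m0 n k) * 2 ^- n.
pose G n := \sum_(k < (2 ^ n)%N) absorbed r t (density r K t m0 n k) * 2 ^- n.
have PG n j : P n j.+1 <= G n + P n.+1 j.
  rewrite /P (sum_pow2S n (fun k => captured r K t eps j
    (density r K t m0 n.+1 k) * 2 ^- n.+1)) -big_split /=; apply: ler_sum => k _.
  rewrite -!mulrDl.
  rewrite odd_double uphalf_double doubleK exprS invfM.
  rewrite [leRHS](_ : _ = (absorbed r t (density r K t m0 n k) +
    (captured r K t eps j (child_density r K t false (density r K t m0 n k)) +
     captured r K t eps j (child_density r K t true (density r K t m0 n k))) / 2)
    * 2 ^- n); last by ring.
  rewrite ler_pM2r ?invr_gt0 ?exprn_gt0//.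
  apply: captured_step => //.
  by case/andP: (density_bounds r K t m0 n k r0 K2 ht Kt hm).
(* With no generation left the survivor bound is the full density, which leaves minus the excess. *)
have P0 n : P n 0%N <= 0.
  rewrite /P -oppr_ge0 -sumrN; apply: sumr_ge0 => k _.
  rewrite /captured /survivor expr0 /excess -mulNr mulr_ge0 ?invr_ge0 ?exprn_ge0//.
  have /andP[d0 _] := density_bounds r K t m0 n k r0 K2 ht Kt hm.
  have := mulr_ge0 d0 (powR_ge0 (density r K t m0 n k / t) (K ^- 2)).
  by lra.
have main j n : P n j <= \sum_(i < j) G (n + i)%N.
  elim: j n => [|j IH] n; first by rewrite big_ord0 P0.
  rewrite big_ord_recl addn0 (le_trans (PG n j))// lerD2l (le_trans (IH _))//.
  by apply: ler_sum => i _; rewrite addSnnS.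
have := main L 0%N; rewrite /P big_ord_recl big_ord0 addr0 expr0 invr1 mulr1.
exact.
Qed.

(** As fractions of m0, the excess takes 1/4 and the survivors at most 1/8 + 7/64, so at least 33/64
    is absorbed. *)
Lemma density_parameters {R : realType} (r K : R) : 0 < r -> 2 <= K ->
  exists t m0 : R, exists L : nat,
  [/\ 0 < t <= 2^-1, K * t `^ r <= 2^-1, 0 < m0 <= 1 &
   m0 / 2 <= \sum_(n < L) \sum_(k < (2 ^ n)%N)
     absorbed r t (density r K t m0 n k) * 2 ^- n].
Proof.
move=> r0 K2; have K0 : 0 < K by lra.
(* The second term solves K t^r = 1/2. *)
pose t := Num.min 2^-1 ((2 * K)^-1 `^ r^-1).
have h0 : 0 < (2 * K)^-1 `^ r^-1 by apply: powR_gt0; rewrite invr_gt0; lra.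
have t0 : 0 < t by rewrite /t lt_min h0 invr_gt0 ltr0n.
have t2 : t <= 2^-1 by rewrite /t ge_min lexx.
have Kt : K * t `^ r <= 2^-1.
  have h : t `^ r <= ((2 * K)^-1 `^ r^-1) `^ r.
    by apply: ge0_ler_powR; rewrite ?nnegrE ?(ltW r0) ?(ltW t0) ?(ltW h0)// /t ge_min lexx orbT.
  rewrite -powRrM mulVf ?gt_eqF// powRr1 in h; last first.
    by rewrite invr_ge0; lra.
  rewrite (_ : 2^-1 = K * (2 * K)^-1) ?ler_pM2l//.
  by rewrite invfM mulrCA mulfV ?mulr1// gt_eqF.
pose e := K ^- 2.
have e0 : 0 < e by rewrite invr_gt0 exprn_gt0.
(* This is t 4^(-K^2), chosen so that (m0/t)^e = 1/4. *)
pose m0 := t * 4^-1 `^ e^-1.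
have ei0 : 0 < e^-1 by rewrite invr_gt0.
have a0 : 0 < (4^-1 : R) `^ e^-1 by apply: powR_gt0; rewrite invr_gt0.
have a1 : (4^-1 : R) `^ e^-1 <= 1.
  have h : (4^-1 : R) `^ e^-1 <= 1 `^ e^-1.
    by apply: ge0_ler_powR; rewrite ?nnegrE ?(ltW ei0)//; lra.
  by rewrite powR1 in h.
have m00 : 0 < m0 by rewrite mulr_gt0.
have m01 : m0 <= 1 by rewrite /m0; nra.
have hex : excess (K ^- 2) t m0 = m0 / 4.
  have -> : excess (K ^- 2) t m0 = m0 * (4^-1 `^ e^-1) `^ e.
    by rewrite /excess -/e [m0 / t]mulrAC divff ?mul1r// gt_eqF.
  by rewrite -powRrM mulVf ?gt_eqF// powRr1// invr_ge0.
pose eps := m0 / 8.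
have eps0 : 0 < eps by rewrite divr_gt0.
have eps1 : eps <= 1 by rewrite /eps; lra.
have k0 : 0 < eps `^ r by apply: powR_gt0.
have k1 : eps `^ r < 1.
  have h : eps `^ r < 1 `^ r.
    by apply: gt0_ltr_powR; rewrite ?nnegrE ?(ltW eps0)// /eps; lra.
  by rewrite powR1 in h.
have [L hL] : exists L, (1 - eps `^ r ^+ 2) ^+ L <= 8^-1.
  have hq : `|1 - eps `^ r ^+ 2| < 1.
    by rewrite ger0_norm ?ltrBlDr ?ltrDl ?exprn_gt0// subr_ge0; nra.
  have /cvgrPdist_le/(_ 8^-1) := cvg_expr hq.
  case=> [|L _ /(_ L (leqnn L))]; first by rewrite invr_gt0.
  by rewrite sub0r normrN => /(le_trans (ler_norm _)) hL; exists L.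
exists t, m0, L; split => //; rewrite ?t0 ?m00//.
have he : 0 < eps <= 1 by rewrite eps0.
have hm : 0 <= m0 <= 1 by rewrite ltW.
have ht : 0 < t <= 2^-1 by rewrite t0.
apply: le_trans (captured_le_absorbed r K t eps m0 L r0 K2 ht Kt he hm).
rewrite /captured hex /survivor; move: hL; move: (_ ^+ L) => z hz.
have : z * (m0 - eps) <= 8^-1 * (m0 - eps).
  by apply: ler_wpM2r => //; rewrite /eps; lra.
by rewrite /eps; lra.
Qed.

(** * Dyadic arcs and their inclusions *)

Local Open Scope classical_set_scope.

(** The equality gives cos(2 pi (t - u)) = 1, hence sin(pi |t - u|) = 0, while the sine is positive
    on ]0, pi[. *)
Lemma circle_point_inj {R : realType} (t u : R) :
  `|t - u| < 1 -> circle_point t = circle_point u -> t = u.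
Proof.
move=> tu [hc hs].
have h1 : cos (2 * pi * (t - u)) = 1 :> R.
  by rewrite mulrBr cosB hc hs -!expr2 cos2Dsin2.
have h2 : sin (pi * `|t - u|) = 0 :> R.
  have h : cos (pi * `|t - u| *+ 2) = 1 :> R.
    rewrite -h1 -mulr_natl mulrA; case: (ger0P (t - u)) => _ //.
    by rewrite mulrN cosN.
  move: h; rewrite cos_mulr2n cos2sin2 => /eqP.
  rewrite -mulr_natl [X in X == _](_ : _ = 1 - 2 * sin (pi * `|t - u|) ^+ 2); last by ring.
  rewrite -subr_eq0 addrAC subrr add0r oppr_eq0 mulf_eq0 pnatr_eq0 /=.
  by rewrite expf_eq0 /= => /eqP.
apply/eqP; rewrite -subr_eq0 -normr_eq0 eq_le normr_ge0 andbT leNgt.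
apply/negP => d0; have : 0 < sin (pi * `|t - u|).
  by apply: sin_gt0_pi; rewrite mulr_gt0 ?pi_gt0// gtr_pMr ?pi_gt0.
by rewrite h2 ltxx.
Qed.

Lemma circle_point_norm {R : realType} (t : R) : `|circle_point t| = 1.
Proof. by rewrite normc_def /= cos2Dsin2 sqrtr1. Qed.

(** Combinatorial form of the inclusion of [I] in [J]: the quotient is the index of the ancestor of
    [I] in the generation of [J]. *)
Definition is_descendant (J I : nat * nat) : bool :=
  (J.1 <= I.1)%N && (I.2 %/ 2 ^ (I.1 - J.1) == J.2)%N.

Definition left_end {R : realType} (x : R) (I : nat * nat) : R :=
  x + I.2%:R * arc_length R I.

Lemma arc_length_gt0 {R : realType} I : 0 < arc_length R I.
Proof. by rewrite invr_gt0 exprn_gt0. Qed.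

(* [Defs.arc] has to be qualified: [arc] is also the cycle arc of [path]. *)
Lemma mem_arc {R : realType} (x t : R) (J : nat * nat) :
  J \in dyadic -> x <= t < x + 1 ->
  Defs.arc x J (circle_point t) <->
  J.2%:R * arc_length R J <= t - x < J.2.+1%:R * arc_length R J.
Proof.
rewrite inE /dyadic /= => hJ /andP[xt tx]; split; last first.
  move=> /andP[h1 h2]; exists t => //=.
  by rewrite in_itv /=; apply/andP; split; lra.
move=> [u /=]; rewrite in_itv /= => /andP[h1 h2] /esym.
have h0 : 0 <= J.2%:R * arc_length R J.
  by rewrite mulr_ge0// ltW// arc_length_gt0.
have h3 : J.2.+1%:R * arc_length R J <= 1.
  by rewrite ler_pdivrMr ?exprn_gt0// mul1r -natrX ler_nat.
(* Both [u] and [t] lie in [x, x + 1[, hence at distance less than 1. *)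
move/circle_point_inj => ->; first by apply/andP; split; lra.
by rewrite ltr_norml; apply/andP; split; lra.
Qed.

Lemma left_end_itv {R : realType} (x : R) (I : nat * nat) : I \in dyadic ->
  x <= left_end x I < x + 1.
Proof.
rewrite inE /dyadic /left_end /= => hI.
rewrite lerDl mulr_ge0 ?(ltW (arc_length_gt0 _))//= ltrD2l.
by rewrite ltr_pdivrMr ?exprn_gt0// mul1r -natrX ltr_nat.
Qed.

Lemma left_end_arc {R : realType} (x : R) (I J : nat * nat) :
  I \in dyadic -> J \in dyadic -> (J.1 <= I.1)%N ->
  Defs.arc x J (circle_point (left_end x I)) <-> is_descendant J I.
Proof.
move=> hI hJ IJ; rewrite mem_arc// ?left_end_itv// /is_descendant IJ /=.
rewrite /left_end addrAC subrr add0r /arc_length.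
have -> : 2 ^- I.1 = 2 ^- (I.1 - J.1) * 2 ^- J.1 :> R.
  by rewrite -invfM -exprD subnK.
rewrite !mulrA !ler_pM2r ?ltr_pM2r ?invr_gt0 ?exprn_gt0//.
rewrite ler_pdivlMr ?ltr_pdivrMr ?exprn_gt0// -natrX -!natrM ler_nat ltr_nat.
by rewrite eqn_leq -leq_divRL ?expn_gt0// andbC -[(_ <= J.2)%N]ltnS ltn_divLR ?expn_gt0.
Qed.

(** If [J] were of a later generation, [I] would contain its own left end and the point one length
    of [J] further on; the half-open arc [J] cannot contain both. *)
Lemma arc_subset_descendant {R : realType} (x : R) (I J : nat * nat) :
  I \in dyadic -> J \in dyadic -> Defs.arc x I `<=` Defs.arc x J -> is_descendant J I.
Proof.
move=> hI hJ IJ; have aI : Defs.arc x I (circle_point (left_end x I)).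
  by apply/left_end_arc => //; rewrite /is_descendant leqnn subnn divn1 eqxx.
case: (leqP J.1 I.1) => [le|lt]; first by apply/(@left_end_arc R x) => //; exact: IJ.
have lJ : arc_length R J < arc_length R I.
  by rewrite /arc_length ltf_pV2 ?posrE ?exprn_gt0// ltr_eXn2l// ltr1n.
have J0 := @arc_length_gt0 R J.
move: (hI); rewrite inE /dyadic /= => hI'.
have h3 : I.2.+1%:R * arc_length R I <= 1.
  by rewrite ler_pdivrMr ?exprn_gt0// mul1r -natrX ler_nat.
have h0 : 0 <= I.2%:R * arc_length R I.
  by rewrite mulr_ge0// ltW// arc_length_gt0.
have e3 : I.2.+1%:R * arc_length R I = I.2%:R * arc_length R I + arc_length R I.
  by rewrite -addn1 natrD mulrDl mul1r.
have e4 : J.2.+1%:R * arc_length R J = J.2%:R * arc_length R J + arc_length R J.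
  by rewrite -addn1 natrD mulrDl mul1r.
have : Defs.arc x I (circle_point (left_end x I + arc_length R J)).
  by apply/mem_arc => //; rewrite /left_end; apply/andP; split; lra.
move/IJ; move/IJ: aI; rewrite !mem_arc//; last 2 first.
- by rewrite /left_end; apply/andP; split; lra.
- exact: left_end_itv.
by rewrite /left_end => /andP[? ?] /andP[? ?]; lra.
Qed.

Lemma arc_root {R : realType} (x : R) (I : nat * nat) :
  I \in dyadic -> Defs.arc x I `<=` Defs.arc x (0, 0)%N.
Proof.
rewrite inE /dyadic /= => hI z [t /=]; rewrite in_itv /= => /andP[h1 h2] <-.
have h3 : I.2.+1%:R * arc_length R I <= 1.
  by rewrite ler_pdivrMr ?exprn_gt0// mul1r -natrX ler_nat.
have h0 : 0 <= I.2%:R * arc_length R I.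
  by rewrite mulr_ge0// ltW// arc_length_gt0.
exists t => //=; rewrite in_itv /= /arc_length /= expr0 invr1.
by apply/andP; split; lra.
Qed.

(** * Point masses in tents *)

(* The atom of I has radius [1 - (3/4)|I|], strictly between [1 - |I|] and
   [1 - |I|/2], so that it lies in the tent of I but in no smaller tent. *)
Definition atom_radius (R : realType) (I : nat * nat) : R :=
  1 - 3 / 4 * arc_length R I.

Lemma arc_length_le1 {R : realType} I : arc_length R I <= 1.
Proof. by rewrite invf_le1 ?exprn_gt0// exprn_ege1// ler1n. Qed.

Lemma atom_radius_itv {R : realType} I : 0 < atom_radius R I < 1.
Proof.
have := @arc_length_gt0 R I; have := @arc_length_le1 R I.
by rewrite /atom_radius => ? ?; apply/andP; split; lra.
Qed.

Fact atom_subproof {R : realType} (x : R) (I : nat * nat) :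
  ((atom_radius R I)%:C%C * circle_point (left_end x I) : cplx R)
    \in unit_disc R.
Proof.
rewrite inE /unit_disc /= normrM circle_point_norm mulr1.
have /andP[r0 r1] := @atom_radius_itv R I.
by rewrite ger0_norm ?lecR ?ltcR// ltW.
Qed.

Definition atom {R : realType} (x : R) (I : nat * nat) : disc R :=
  exist (fun z : cplx R => z \in unit_disc R) _ (atom_subproof x I).

(** Comparing moduli recovers the radius; cancelling it, as it is nonzero, recovers the point of the
    circle. The radius condition says that [J] is not of a later generation than [I]. *)
Lemma atom_tent {R : realType} (x : R) (I J : nat * nat) :
  I \in dyadic -> J \in dyadic -> (tent x J (atom x I)) <-> is_descendant J I.
Proof.
move=> hI hJ.
have /andP[r0 r1] := @atom_radius_itv R I.
have rJ : (1 - arc_length R J <= atom_radius R I) = (J.1 <= I.1)%N.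
  rewrite /atom_radius lerD2l lerN2; case: (leqP J.1 I.1) => IJ.
    have : arc_length R I <= arc_length R J.
      by rewrite /arc_length lef_pV2 ?posrE ?exprn_gt0// ler_eXn2l// ltr1n.
    by have := @arc_length_gt0 R I; lra.
  apply/negbTE; rewrite -ltNge.
  have : arc_length R J <= 2^-1 * arc_length R I.
    rewrite /arc_length -invfM -exprS lef_pV2 ?posrE ?exprn_gt0//.
    by rewrite ler_eXn2l// ltr1n.
  by have := @arc_length_gt0 R I; lra.
split.
  move=> [r [t [e /andP[h1 h2] ht]]].
  have J1 := @arc_length_le1 R J.
  have er : atom_radius R I = r.
    have := congr1 (fun z : cplx R => `|z|) e.
    rewrite /= !normrM !circle_point_norm !mulr1 !ger0_norm ?lecR ?(ltW r0)//.
      by move=> [].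
    by lra.
  have et : circle_point (left_end x I) = circle_point t.
    move: e; rewrite /= -er => /mulfI; apply.
    by rewrite (inj_eq (@complexI R)) gt_eqF.
  rewrite -et in ht; rewrite -er rJ in h1.
  by apply/(@left_end_arc R x).
move=> IJ; have le : (J.1 <= I.1)%N by case/andP: IJ.
exists (atom_radius R I), (left_end x I); split => //; first by rewrite rJ le.
by apply/left_end_arc.
Qed.

(** The formula covers every set [A], since Dirac masses are given by indicators on all sets; hence
    it applies to tents directly. *)
Lemma atomic_measure (d : measure_display) (T : measurableType d)
    {R : realType} {X : Type} (s : seq X) (w : X -> R) (z : X -> T) :
  (forall i, 0 <= w i) ->
  exists mu : {finite_measure set T -> \bar R},
    forall A, mu A = (\sum_(i <- s) w i * \1_A (z i))%:E.
Proof.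
move=> w0; elim: s => [|i s [mu IH]].
  have h : fin_num_fun (@mzero d T R) by move=> A _.
  pose mu : {finite_measure set T -> \bar R} :=
    HB.pack (@mzero d T R) (@Measure_isFinite.Build d T R _ h).
  by exists mu => A; rewrite big_nil.
pose nu : {measure set T -> \bar R} :=
  measure_add (mscale (NngNum (w0 i)) (dirac (z i))) mu.
have nuE A : nu A = (\sum_(j <- i :: s) w j * \1_A (z j))%:E.
  transitivity ((mscale (NngNum (w0 i)) (dirac (z i))) A + mu A)%E.
    exact: measure_addE.
  by rewrite IH big_cons EFinD EFinM.
have h : fin_num_fun nu by move=> A _; rewrite nuE.
pose rho : {finite_measure set T -> \bar R} :=
  HB.pack (nu : set T -> \bar R) (Measure.class nu) (@Measure_isFinite.Build d T R _ h).
by exists rho => A; rewrite -nuE.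
Qed.

(** * Sums over the dyadic tree *)

Definition dyadic_upto (B : nat) : seq (nat * nat) :=
  [seq (n, k) | n <- iota 0 B, k <- iota 0 (2 ^ n)].

Lemma big_dyadic_upto {V : nmodType} (B : nat) (f : nat * nat -> V) :
  \sum_(I <- dyadic_upto B) f I = \sum_(n < B) \sum_(k < (2 ^ n)%N) f (n : nat, k : nat).
Proof.
rewrite big_allpairs_dep -{1}[B]subn0 -/(index_iota 0 B) big_mkord.
apply: eq_bigr => n _.
by rewrite -{1}[(2 ^ n)%N]subn0 -/(index_iota 0 (2 ^ n)) big_mkord.
Qed.

Lemma mem_dyadic_upto (B : nat) (I : nat * nat) :
  (I \in dyadic_upto B) = (I.1 < B)%N && (I.2 < 2 ^ I.1)%N.
Proof.
apply/allpairsPdep/andP => [[n [k []]]|[h1 h2]].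
  by rewrite !mem_iota !add0n => /andP[_ ?] /andP[_ ?] ->.
by exists I.1, I.2; rewrite !mem_iota !add0n h1 h2; case: I {h1 h2}.
Qed.

Lemma uniq_dyadic_upto (B : nat) : uniq (dyadic_upto B).
Proof.
apply: allpairs_uniq_dep; rewrite ?iota_uniq//; first by move=> n _; exact: iota_uniq.
by move=> [n k] [n' k'] _ _ /= [-> ->].
Qed.

Lemma is_descendant_child (J : nat * nat) n k : (J.1 <= n)%N ->
  (is_descendant J (n.+1, k.*2) = is_descendant J (n, k)) *
  (is_descendant J (n.+1, k.*2.+1) = is_descendant J (n, k)).
Proof.
move=> Jn; rewrite /is_descendant /= Jn (leqW Jn) /= subSn// expnS !divnMA.
by rewrite !divn2 doubleK -uphalfE uphalf_double.
Qed.

(** The sum telescopes by generations: the descendants of [J] in generation n + 1 are the children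
    of those in generation n. *)
Lemma sum_descendants {V : zmodType} (J : nat * nat) (f : nat * nat -> V) B :
  (J.2 < 2 ^ J.1)%N -> (J.1 <= B)%N ->
  \sum_(I <- dyadic_upto B | is_descendant J I)
     (f I - (f (child_plus I) + f (child_minus I)))
  = f J - \sum_(k < (2 ^ B)%N | is_descendant J (B, k : nat)) f (B, k : nat).
Proof.
move=> hJ JB; rewrite big_mkcond big_dyadic_upto -(subnK JB).
elim: (B - J.1)%N => [|m IH].
  rewrite add0n big1 => [|n _]; last first.
    by rewrite big1// => k _; rewrite /is_descendant /= leqNgt ltn_ord.
  rewrite (eq_bigl (fun k => k == Ordinal hJ)) => [|k].
    by rewrite big_pred1_eq -surjective_pairing subrr.
  by rewrite /is_descendant leqnn subnn divn1.
rewrite addSn big_ord_recr /= {}IH.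
rewrite [in RHS]big_mkcond (sum_pow2S (m + J.1) (fun k =>
  if is_descendant J ((m + J.1).+1, k) then f ((m + J.1).+1, k) else 0)).
rewrite [X in _ - X + _]big_mkcond -addrA; congr (_ + _).
rewrite addrC -sumrB -sumrN; apply: eq_bigr => k _.
rewrite !(is_descendant_child J _ _ (leq_addl _ _)).
case: ifP => _; last by rewrite subrr addr0 oppr0.
by rewrite addrAC subrr add0r.
Qed.

Lemma esum_dyadic_le {R : realType} (B : nat) (J : nat * nat)
    (S : set (nat * nat)) (a : nat * nat -> R) :
  (forall I, 0 <= a I) -> (forall I, (B <= I.1)%N -> a I = 0) ->
  (forall I, S I -> dyadic I /\ is_descendant J I) ->
  (\esum_(I in S) (a I)%:E
    <= (\sum_(I <- dyadic_upto B | is_descendant J I) a I)%:E)%E.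
Proof.
move=> a0 aB hS.
pose r := [seq I <- dyadic_upto B | is_descendant J I].
apply: (@le_trans _ _ (\esum_(I in [set` r]) (a I)%:E)%E).
  rewrite esum_mkcond [leRHS]esum_mkcond; apply: le_esum => I _.
  case: ifPn => [|_]; last by case: ifP; rewrite ?lee_fin.
  rewrite inE => /hS[hI JI]; case: (ltnP I.1 B) => IB; last first.
    by rewrite aB//; case: ifP.
  by rewrite mem_set//= mem_filter JI mem_dyadic_upto IB.
rewrite esum_fset; first last.
- by move=> I _; rewrite lee_fin.
- exact: finite_seq.
rewrite -fsbig_seq ?filter_uniq ?uniq_dyadic_upto//.
by rewrite big_filter sumEFin.
Qed.

Lemma esum_dyadic_ge {R : realType} (B : nat) (S : set (nat * nat))
    (a : nat * nat -> R) :
  (forall I, dyadic I -> S I) ->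
  ((\sum_(n < B) \sum_(k < (2 ^ n)%N) a (n : nat, k : nat))%:E
    <= \esum_(I in S) (a I)%:E)%E.
Proof.
move=> hS; rewrite -(big_dyadic_upto B a).
apply: esum_ge; exists [set` dyadic_upto B].
  split; first exact: finite_seq.
  move=> I /=; rewrite mem_dyadic_upto => /andP[_ h]; exact: hS.
by rewrite -fsbig_seq ?uniq_dyadic_upto// sumEFin.
Qed.

(** * Exponent arithmetic and the two energy bounds *)

Lemma powR_conjugate_exponents {R : realType} (p m : R) : 2 < p -> 0 <= m ->
  (m `^ (p / (p - 2)) = m * m `^ (p - 2)^-1 ^+ 2) *
  ((m * m `^ (p - 2)^-1) `^ (p / (p - 1)) = m * m `^ (p - 2)^-1 ^+ 2).
Proof.
move=> p2; have n1 : p - 2 != 0 by rewrite gt_eqF//; lra.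
have n2 : p - 1 != 0 by rewrite gt_eqF//; lra.
have n0 : p != 0 by rewrite gt_eqF//; lra.
(* The case m = 0 is apart because powers are added below with a nonzero base. *)
rewrite le_eqVlt => /predU1P[<-|m0].
  by rewrite !mul0r !powR0// mulf_neq0// invr_eq0.
have mD a b : m `^ a * m `^ b = m `^ (a + b).
  by rewrite powRD// (gt_eqF m0)/= implybT.
have mr a : m * m `^ a = m `^ (1 + a) by rewrite -mD powRr1// ltW.
rewrite expr2 mD !mr -powRrM.
by split; congr (_ `^ _); field; rewrite ?n1 ?n2.
Qed.

Local Close Scope classical_set_scope.

Theorem theorem1p4 (R : realType) (p : R) (hp : 2 < p) :
  exists C c : R, [/\ 0 < C, 0 < c &
    forall (x : R) (N : nat), (2 <= N)%N ->
    exists mu : {finite_measure set (disc R) -> \bar R},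
      (packing_energy p x mu <= C%:E)%E /\
      ((c * N%:R `^ (p / (p - 1)))%:E <= haar_energy p x mu)%E].
Proof.
(* Packing holds with constant 1 by telescoping; 1/2 is the share of the root mass that is
   absorbed. *)
exists 1, 2^-1; split; rewrite ?invr_gt0// => x N N2.
pose K : R := N%:R; have K2 : 2 <= K by rewrite ler_nat.
pose r := (p - 2)^-1; have r0 : 0 < r by rewrite invr_gt0 subr_gt0.
have [t [m0 [L [ht Kt /andP[m00 m01] hL]]]] := density_parameters r K r0 K2.
have hm : 0 <= m0 <= 1 by rewrite ltW.
have db n k := density_bounds r K t m0 n k r0 K2 ht Kt hm.
(* The cut-off after generation [L] leaves finitely many atoms; the weight [w I] is the mass lost at
   [I]. *)
pose mass (I : nat * nat) := if (I.1 <= L)%N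
  then density r K t m0 I.1 I.2 * arc_length R I else 0.
pose w I := mass I - (mass (child_plus I) + mass (child_minus I)).
have al I := @arc_length_gt0 R I.
have mass0 I : 0 <= mass I.
  rewrite /mass; case: ifP => // _; apply: mulr_ge0; last exact: ltW.
  by case/andP: (db I.1 I.2).
have massE I : mass I / arc_length R I =
    if (I.1 <= L)%N then density r K t m0 I.1 I.2 else 0.
  by rewrite /mass; case: ifP => _; rewrite ?mul0r// mulfK// gt_eqF.
have childE I : (I.1 < L)%N ->
    mass (child_plus I) = child_density r K t false (density r K t m0 I.1 I.2)
                          * arc_length R I / 2 /\
    mass (child_minus I) = child_density r K t true (density r K t m0 I.1 I.2)
                          * arc_length R I / 2.
  move=> IL; rewrite /mass IL !density_children /arc_length /= exprS invfM.
  by split; ring.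
pose pack I := (mass I / arc_length R I) `^ (p / (p - 2)) * arc_length R I.
have pack0 I : 0 <= pack I by rewrite mulr_ge0 ?powR_ge0// ltW.
have q0 : p / (p - 2) != 0 by rewrite gt_eqF// divr_gt0//; lra.
have packw I : pack I <= w I.
  rewrite /pack massE; case: (ltngtP I.1 L) => IL.
  - have /andP[d0 d1] := db I.1 I.2.
    rewrite (powR_conjugate_exponents _ _ hp d0) -/r /w.
    have [-> ->] := childE I IL; rewrite /mass (ltnW IL).
    have := child_density_loss r K t _ r0 (db I.1 I.2).
    by move=> /(ler_wpM2r (ltW (al I))); lra.
  - rewrite powR0// mul0r /w /mass [(I.1 <= L)%N]leqNgt IL /=.
    by rewrite !ltnNge (ltnW IL) /= addr0 subr0.
  (* In generation [L] the whole mass stays in the atom; dropping the nonnegative child densities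
     from the loss bound suffices. *)
  - have /andP[d0 d1] := db I.1 I.2.
    rewrite (powR_conjugate_exponents _ _ hp d0) -/r.
    rewrite /w /mass /= IL ltnn leqnn addr0 subr0 ler_wpM2r ?(ltW (al I))//.
    have := child_density_loss r K t _ r0 (db I.1 I.2).
    have /andP[c0 _] := child_density_bounds r K t false _ r0 K2 ht Kt d0.
    have /andP[c1 _] := child_density_bounds r K t true _ r0 K2 ht Kt d0.
    by rewrite -IL; lra.
have w0 I : 0 <= w I by exact: le_trans (packw I).
have [mu muE] := atomic_measure _ (disc R) (dyadic_upto L.+1) w (atom x) w0.
have tentE J : dyadic J ->
    \sum_(I <- dyadic_upto L.+1 | is_descendant J I) w I = mass J.
  move=> hJ; case: (leqP J.1 L) => JL.
    rewrite sum_descendants// ?(leqW JL)// big1 ?subr0// => k _.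
    by rewrite /mass /= ltnn.
  rewrite [RHS]/mass leqNgt JL /= big_seq_cond big1// => I.
  rewrite mem_dyadic_upto => /andP[/andP[IL _]] /andP[JI _].
  by move: (leq_trans JL JI); rewrite leqNgt IL.
have tmE J : dyadic J -> tent_mass x mu J = mass J.
  move=> hJ; rewrite /tent_mass muE -(tentE J hJ) /= [RHS]big_mkcond /=.
  rewrite big_seq [RHS]big_seq; apply: eq_bigr => I.
  rewrite mem_dyadic_upto => /andP[_ hI]; rewrite indicE.
  have h := atom_tent x I J (mem_set hI) (mem_set hJ).
  case: ifPn => JI; first by rewrite mem_set ?mulr1//; apply/h.
  by rewrite memNset ?mulr0// => /h; exact/negP.
(* Positive total mass selects the supremum in [carleson_sup] rather than the default value 0. *)
have muT : mu setT <> 0%E.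
  rewrite muE => -[] /eqP; rewrite gt_eqF//.
  apply: (lt_le_trans m00); have <- : mass (0, 0)%N = m0.
    by rewrite /mass /= /arc_length /= expr0 invr1 mulr1.
  rewrite -tentE// big_mkcond; apply: ler_sum => I _.
  by rewrite indicE in_setT mulr1; case: ifP.
move/eqP/negbTE: muT => muT.
exists mu; split.
  rewrite /packing_energy /carleson_sup muT; apply: ge_ereal_sup => _ [J [hJ J0] <-].
  rewrite /= (tmE J hJ) in J0 *.
  rewrite lee_pdivrMl// mule1.
  rewrite (eq_esum (b := fun I => (pack I)%:E)); last first.
    by move=> I [hI _]; rewrite tmE.
  rewrite -(tentE J hJ).
  apply: (@le_trans _ _ (\sum_(I <- dyadic_upto L.+1 | is_descendant J I) pack I)%:E).
    apply: esum_dyadic_le => //.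
      by move=> I LI; rewrite /pack massE leqNgt LI /= powR0// mul0r.
    move=> I [hI hIJ]; split=> //.
    by apply: (arc_subset_descendant x) hIJ; exact: mem_set.
  by rewrite lee_fin; apply: ler_sum => I _.
have root : dyadic (0, 0)%N by [].
have root_mass : tent_mass x mu (0, 0)%N = m0.
  by rewrite tmE// /mass /= /arc_length /= expr0 invr1 mulr1.
(* The root arc alone already gives the Haar lower bound. *)
rewrite /haar_energy /carleson_sup muT; apply: le_trans; last first.
  by apply: ereal_sup_ubound; exists (0, 0)%N => //; split => //=; rewrite root_mass.
rewrite root_mass lee_pdivlMl// -EFinM.
pose haar I := (`|tent_mass x mu (child_plus I) - tent_mass x mu (child_minus I)|
       / arc_length R I) `^ (p / (p - 1)) * arc_length R I.
have hS I : dyadic I ->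
    (dyadic `&` [set I | Defs.arc x I `<=` Defs.arc x (0, 0)%N])%classic I.
  by move=> hI; split => //; apply: arc_root; exact: mem_set.
apply: le_trans (esum_dyadic_ge L _ haar hS).
rewrite lee_fin.
have : K `^ (p / (p - 1)) * (m0 / 2) <= \sum_(n < L) \sum_(k < (2 ^ n)%N)
    K `^ (p / (p - 1)) * (absorbed r t (density r K t m0 n k) * 2 ^- n).
  under eq_bigr do rewrite -mulr_sumr.
  by rewrite -mulr_sumr ler_wpM2l ?powR_ge0.
rewrite [leLHS](_ : _ = m0 * (2^-1 * N%:R `^ (p / (p - 1)))); last first.
  by rewrite -/K; ring.
move=> /le_trans; apply.
apply: ler_sum => n _; apply: ler_sum => k _.
have hI : dyadic (n : nat, k : nat) by rewrite /dyadic /=.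
have hp' : dyadic (child_plus (n : nat, k : nat)).
  by rewrite /dyadic /= expnS mul2n ltn_double.
have hm' : dyadic (child_minus (n : nat, k : nat)).
  by rewrite /dyadic /= expnS mul2n -doubleS leq_double.
have /andP[d0 d1] := db n k.
rewrite /haar !tmE// mulrA.
have [-> ->] := childE (n : nat, k : nat) (ltn_ord n); rewrite /=.
apply: ler_wpM2r; first by rewrite invr_ge0 exprn_ge0.
(* Above t nothing counts as absorbed; up to t the Haar summand is exactly N^(p/(p-1)) times the
   absorbed mass. *)
rewrite /absorbed; case: ifPn => mt; last by rewrite mulr0 powR_ge0.
have n0 : arc_length R (n : nat, k : nat) != 0 by rewrite gt_eqF.
rewrite -!mulrBl mulrAC child_density_diff//.
rewrite normrM (ger0_norm (ltW (al _))) mulfK// ger0_norm; last first.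
  by rewrite !mulr_ge0// powR_ge0.
rewrite -mulrA powRM ?mulr_ge0 ?powR_ge0//.
by rewrite (powR_conjugate_exponents _ _ hp d0).
Qed.
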